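(* Let $X$ be a $k$-regular connected graph and $S$ a nonempty set of marked vertices, $\overline S=V\setminus S$. Let $A(X\setminus S)=\sum_r\lambda_rG_r$ be the spectral decomposition of $X\setminus S$. Let $L'$ and $Q'$ be the Laplacian and signless Laplacian of the subgraph $X-E(S)$ obtained from $X$ by removing all edges of the induced subgraph $X[S]$. Then, entrywise, $$\widehat{M}[S,S]\ge\frac{1}{2k}Q(X[S])+\Delta(S,\overline S)^\dagger\sum_r\frac{k}{2(k^2-\lambda_r^2)^2}(HG_rH^T)^{\circ2}+\Delta(S,\overline S)^\dagger\left(\frac{1}{4k}(L'/L_{\overline S})^{\circ2}+\frac{1}{4k}(Q'/Q_{\overline S})^{\circ2}\right).$$ Moreover, equality holds if and only if $S$ has walk-equitable neighborhoods in $X\setminus S$.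
   Context: Walk: arcs are ordered pairs $(u,v)$ of adjacent vertices; $R$ the arc-reversal matrix; $D_t$ the tail incidence matrix ($(D_t)_{x,(u,v)}=1$ iff $x=u$); $O_S$ the identity with $[S,S]$ block zeroed; $U=R(\frac2kD_t^TO_SD_t-I)$. Average vertex mixing matrix: $\widehat M_{u,v}=\lim_{T\to\infty}\frac1T\sum_{t=0}^{T-1}\sum_{w\sim u}|(U^tx_v)_{(u,w)}|^2$, $x_v=k^{-1/2}D_t^Te_v$. Write $A=\begin{pmatrix}A_S&H\\H^T&A_{\overline S}\end{pmatrix}$, $L=kI-A$, $Q=kI+A$, $L_{\overline S}=L[\overline S,\overline S]$, $Q_{\overline S}=Q[\overline S,\overline S]$ (these are also the $[\overline S,\overline S]$ blocks of $L'$, $Q'$). For a block matrix $\begin{pmatrix}P_1&P_2\\P_3&P_4\end{pmatrix}$ with $P_4$ invertible, the Schur complement is $P_1-P_2P_4^{-1}P_3$, denoted by dividing by $P_4$; thus $L'/L_{\overline S}=\Delta(S,\overline S)-HL_{\overline S}^{-1}H^T$ and $Q'/Q_{\overline S}=\Delta(S,\overline S)-HQ_{\overline S}^{-1}H^T$. $Q(X[S])$ is the signless Laplacian of the induced subgraph on $S$. $\Delta(T_1,T_2)$ is the diagonal $T_1\times T_1$ matrix recording numbers of neighbors in $T_2$; $\dagger$ is the pseudo-inverse; $\circ$ the Schur product. $S$ has walk-equitable neighborhoods in $X\setminus S$ if for every $m\ge0$ and all $a,b\in S$, the number of walks of length $m$ in $X\setminus S$ from a vertex $u\in N(a)\setminus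 S$ to $N(b)\setminus S$ is independent of the choice of $u\in N(a)\setminus S$. *)

(* Defs.v *)
From HB Require Import structures.
From mathcomp Require Import all_boot all_order all_algebra.
From mathcomp Require Import all_classical all_reals all_analysis.

Set Implicit Arguments.
Unset Strict Implicit.
Unset Printing Implicit Defensive.

Import Order.TTheory GRing.Theory Num.Theory.
Import numFieldNormedType.Exports.

Local Open Scope ring_scope.

(* The matrix with rows indexed by A and columns indexed by B: the elements
   of a finite set are listed by [enum_val].  When f gives the entries of a
   matrix indexed by all vertices, [mxof f A B] is its block [A, B]. *)
Definition mxof (R : realType) (T1 T2 : finType) (f : T1 -> T2 -> R)
    (A : {set T1}) (B : {set T2}) : 'M[R]_(#|A|, #|B|) :=
  \matrix_(i, j) f (enum_val i) (enum_val j).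

Section LinearAlgebra.
Variable R : realType.

Definition spectral_decomposition (n m : nat) (A : 'M[R]_n)
    (lambda : 'I_m -> R) (G : 'I_m -> 'M[R]_n) : Prop :=
  [/\ injective lambda,
      forall r, [/\ G r != 0, (G r)^T = G r & G r *m G r = G r],
      forall r s, r != s -> G r *m G s = 0,
      \sum_r G r = 1%:M
    & A = \sum_r lambda r *: G r].

(* The Penrose equations over the reals, which determine B. *)
Definition is_pseudo_inverse (m n : nat) (A : 'M[R]_(m, n))
    (B : 'M[R]_(n, m)) : Prop :=
  [/\ A *m B *m A = A, B *m A *m B = B,
      (A *m B)^T = A *m B & (B *m A)^T = B *m A].

Definition pseudo_inverse (m n : nat) (A : 'M[R]_(m, n)) : 'M[R]_(n, m) :=
  xget 0 (fun B => is_pseudo_inverse A B).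

Definition schur_prod (m n : nat) (A B : 'M[R]_(m, n)) : 'M[R]_(m, n) :=
  map2_mx *%R A B.

Definition schur_complement (m n : nat) (P1 : 'M[R]_m) (P2 : 'M[R]_(m, n))
    (P3 : 'M[R]_(n, m)) (P4 : 'M[R]_n) : 'M[R]_m :=
  P1 - P2 *m invmx P4 *m P3.

End LinearAlgebra.

Section Graphs.
Variables (R : realType) (V : finType).
Implicit Types (e : rel V) (S T : {set V}).

Definition simple_graph e : Prop := symmetric e /\ irreflexive e.

Definition connected_graph e : Prop := forall x y, connect e x y.

Definition nb_in e T (x : V) : nat := #|[pred y in T | e x y]|.

Definition degree e (x : V) : nat := #|[pred y | e x y]|.

Definition regular_graph e (k : nat) : Prop := forall x, degree e x = k.

(* Entries of the adjacency, Laplacian and signless Laplacian matrices. *)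
Definition adj e (x y : V) : R := (e x y)%:R.

Definition lap e (x y : V) : R := (degree e x)%:R *+ (x == y) - adj e x y.

Definition slap e (x y : V) : R := (degree e x)%:R *+ (x == y) + adj e x y.

(* Edges of the induced subgraph on S; the vertices outside S, isolated here,
   are dropped when only the block [S, S] is taken. *)
Definition edges_in e S : rel V := [rel x y | [&& e x y, x \in S & y \in S]].

Definition remove_edges_in e S : rel V :=
  [rel x y | e x y && ~~ ((x \in S) && (y \in S))].

Definition Delta e S T : 'M[R]_(#|S|) :=
  mxof (fun x y => (nb_in e T x)%:R *+ (x == y)) S S.

(* The Schur complement, in the matrix with entries f, of the block indexed
   by the complement of S. *)
Definition schur_compl_out (f : V -> V -> R) S : 'M[R]_(#|S|) :=
  schur_complement (mxof f S S) (mxof f S (~: S))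
    (mxof f (~: S) S) (mxof f (~: S) (~: S)).

(* A walk of length m from u is given by the m vertices that follow u. *)
Definition nb_walks_out e S (m : nat) (u b : V) : nat :=
  #|[pred p : m.-tuple V |
      [&& path (edges_in e (~: S)) u p,
          last u p \in ~: S & e b (last u p)]]|.

Definition walk_equitable_neighborhoods e S : Prop :=
  forall (m : nat) (a b u u' : V), a \in S -> b \in S ->
    u \in ~: S -> e a u -> u' \in ~: S -> e a u' ->
    nb_walks_out e S m u b = nb_walks_out e S m u' b.

End Graphs.

Section QuantumWalk.
Variables (R : realType) (V : finType) (e : rel V) (k : nat) (S : {set V}).

Definition arcs : {set V * V} := finset (fun a : V * V => e a.1 a.2).

Definition arc_reversal : 'M[R]_(#|arcs|) :=
  mxof (fun a b : V * V => (b == (a.2, a.1))%:R) arcs arcs.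

Definition tail_incidence : 'M[R]_(#|[set: V]|, #|arcs|) :=
  mxof (fun (x : V) (a : V * V) => (x == a.1)%:R) [set: V] arcs.

Definition oracle : 'M[R]_(#|[set: V]|) :=
  mxof (fun x y : V => ((x == y) && (x \notin S))%:R) [set: V] [set: V].

Definition transition : 'M[R]_(#|arcs|) :=
  arc_reversal *m
    ((2 / k%:R) *: (tail_incidence^T *m oracle *m tail_incidence) - 1%:M).

Definition vertex_state (v : V) : 'cV[R]_(#|arcs|) :=
  (Num.sqrt k%:R)^-1 *:
    (tail_incidence^T *m \col_(i < #|[set: V]|) (enum_val i == v)%:R).

(* All the matrices are real, hence so are the amplitudes. *)
Definition mixing (t : nat) (u v : V) : R :=
  \sum_(a < #|arcs| | (enum_val a).1 == u)
    `|(transition ^+ t *m vertex_state v) a 0| ^+ 2.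

Definition avg_mixing (u v : V) : R :=
  lim ((fun T : nat => T%:R^-1 * \sum_(t < T) mixing t u v) @ \oo)%classic.

End QuantumWalk.

(* Main.v *)
(** Let x_v be the state of a marked vertex v. Up to the factor sqrt k, the
    amplitude of U^t x_v at an arc (u, w) is f_t(w) - f_(t-1)(u), where f solves
    a discrete wave equation on the vertices: f_(t+1) = f_(t-1) on S, and
    f_(t+1) + f_(t-1) = (2/k) A f_t outside S. With eta_r = G_r H^T e_v and
    |lambda_r| < k, the solution is explicit, so that for u in S the amplitude is
    a trigonometric sum in t with the distinct frequencies 0, pi and
    arccos (lambda_r / k). The time average of its square is the sum of the
    squared coefficients, with weight 1/2 on the frequencies arccos (lambda_r / k).

    The neighbors w of u in S contribute the signless Laplacian of X[S]. For w in
    N(u) \ S the coefficients are multiples of eta_r(w),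
    delta_uv - (L^-1 H^T)(w, v) and delta_uv - (Q^-1 H^T)(w, v), where L and Q
    are restricted to the complement of S. By Cauchy-Schwarz over w, the sums of
    their squares are bounded below by the squares of their sums, which are the
    entries of H G_r H^T and of the two Schur complements. Equality means that
    every eta_r is constant on N(u) \ S; since walks of length n from w are
    counted by sum_r lambda_r^n eta_r(w) and the lambda_r are distinct, this is
    walk-equitability. *)

Require Import Defs.
From mathcomp Require Import all_boot all_order all_algebra.
From mathcomp Require Import all_classical all_reals all_analysis.
From mathcomp Require Import ring lra.

Set Implicit Arguments.
Unset Strict Implicit.
Unset Printing Implicit Defensive.

Import Order.TTheory GRing.Theory Num.Theory.
Import numFieldNormedType.Exports.

Local Open Scope ring_scope.

(** * Time averages of trigonometric sums *)

Section CesaroMeans.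
Local Open Scope classical_set_scope.
Variable R : realType.
Implicit Types (u v : nat -> R) (l c x y : R).

Definition cesaro_mean u l :=
  (fun T : nat => T%:R^-1 * \sum_(t < T) u t) @ \oo --> l.

Lemma cesaro_mean_ext u v l : u =1 v -> cesaro_mean u l -> cesaro_mean v l.
Proof. by move=> /funext ->. Qed.

Lemma cesaro_mean_const l : cesaro_mean (fun=> l) l.
Proof.
apply: cvg_near_cst; near=> T.
have T0 : (0 < T)%N by near: T; exact: nbhs_infty_gt.
by rewrite sumr_const card_ord -[l *+ T]mulr_natl mulKf // pnatr_eq0 -lt0n.
Unshelve. all: by end_near. Qed.

Lemma cesaro_meanD u v l l' : cesaro_mean u l -> cesaro_mean v l' ->
  cesaro_mean (fun t => u t + v t) (l + l').
Proof.
move=> hu hv; rewrite /cesaro_mean; under eq_fun do rewrite big_split mulrDr.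
exact: cvgD.
Qed.

Lemma cesaro_meanZ c u l : cesaro_mean u l -> cesaro_mean (fun t => c * u t) (c * l).
Proof.
move=> hu; rewrite /cesaro_mean; under eq_fun do rewrite -mulr_sumr mulrCA.
exact: cvgMr.
Qed.

Lemma cesaro_mean_sum (I : Type) (r : seq I) (P : pred I) (u : I -> nat -> R)
    (l : I -> R) : (forall i, cesaro_mean (u i) (l i)) ->
  cesaro_mean (fun t => \sum_(i <- r | P i) u i t) (\sum_(i <- r | P i) l i).
Proof.
move=> h; elim: r => [|i r IH].
  apply: (@cesaro_mean_ext (fun=> 0)); first by move=> t; rewrite big_nil.
  by rewrite big_nil; exact: cesaro_mean_const.
apply: (@cesaro_mean_ext (fun t => (if P i then u i t else 0) + \sum_(j <- r | P j) u j t)).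
  by move=> t; rewrite big_cons; case: ifP => //; rewrite add0r.
rewrite big_cons; case: ifP => _; first exact: cesaro_meanD.
by rewrite -[X in cesaro_mean _ X]add0r; apply: cesaro_meanD => //; exact: cesaro_mean_const.
Qed.

Lemma cesaro_mean_bounded u c :
  (forall T, `|\sum_(t < T) u t| <= c) -> cesaro_mean u 0.
Proof.
move=> h; apply/norm_cvg0P.
have hc : (fun T : nat => c * T%:R^-1 : R) @ \oo --> (0 : R).
  rewrite -(mulr0 c); apply: cvgMr; rewrite -cvg_shiftS; exact: cvg_harmonic.
apply: (squeeze_cvgr _ (cvg_cst 0) hc); apply: nearW => T /=.
rewrite normr_ge0 /= normrM normfV normr_nat mulrC.
by rewrite ler_wpM2r ?invr_ge0 ?ler0n // h.
Qed.

(* Christoffel-Darboux: the products telescope. *)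
Lemma cesaro_mean_cosM x y : cos x != cos y ->
  cesaro_mean (fun t => cos (t%:R * x) * cos (t%:R * y)) 0.
Proof.
move=> ne.
(* [F] is the Casoratian of the two cosine sequences. By [cos ((n+1)x) + cos ((n-1)x) = 2 cos x cos
   (nx)], its increment is [2 cos x - 2 cos y] times the product to be averaged. *)
pose F (n : nat) := cos (n%:R * x) * cos (n%:R * y - y)
                  - cos (n%:R * x - x) * cos (n%:R * y).
have dF n : cos (n%:R * x) * cos (n%:R * y)
          = (2 * cos x - 2 * cos y)^-1 * (F n.+1 - F n).
  have nz : 2 * cos x - 2 * cos y != 0.
    by rewrite -mulrBr mulf_neq0 // ?pnatr_eq0 // subr_eq0.
  apply: (mulfI nz); rewrite mulVKf // /F -(natr1 n) !mulrDl !mul1r !addrK !cosD.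
  by rewrite !cosN !sinN; ring.
have bF n : `|F n| <= 2.
  rewrite /F; apply: (le_trans (ler_normB _ _)); rewrite !normrM -[leRHS]/(1 + 1).
  by apply: lerD; apply: mulr_ile1; rewrite ?normr_ge0 ?cos_max.
apply: (@cesaro_mean_bounded _ (`|(2 * cos x - 2 * cos y)^-1| * 4)) => T.
under eq_bigr do rewrite dF.
rewrite -mulr_sumr normrM ler_wpM2l ?normr_ge0 //.
rewrite -(big_mkord predT (fun t => F t.+1 - F t)) telescope_sumr //.
by have := ler_normB (F T) (F 0%N); have := bF T; have := bF 0%N; lra.
Qed.

Lemma cesaro_mean_cos_sqr x : cesaro_mean (fun t => cos (t%:R * x) * cos (t%:R * x))
  (if cos x ^+ 2 == 1 then 1 else 2^-1).
Proof.
have [c1|nc1] := eqVneq.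
  have s0 : sin x = 0 by apply/eqP; rewrite -sqrf_eq0 sin2cos2 c1 subrr.
  apply: (@cesaro_mean_ext (fun=> 1)); last exact: cesaro_mean_const.
  move=> t; suff /eqP : sin (t%:R * x) = 0.
    by rewrite -sqrf_eq0 sin2cos2 subr_eq0 -expr2 => /eqP.
  elim: t => [|t IH]; first by rewrite mul0r sin0.
  by rewrite -natr1 mulrDl mul1r sinD IH s0 mul0r mulr0 addr0.
(* Double angle formula; the factor [cos (t * 0) = 1] lets [cesaro_mean_cosM] apply with [y = 0]. *)
apply: (@cesaro_mean_ext (fun t => 2^-1 + 2^-1 * (cos (t%:R * (x + x)) * cos (t%:R * 0)))).
  by move=> t; rewrite mulr0 cos0 mulrDr cosD -!expr2 sin2cos2; field.
have ne : cos (x + x) != cos 0.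
  by apply: contra_neq nc1; rewrite cos0 cosD -!expr2 sin2cos2; lra.
have := cesaro_meanD (@cesaro_mean_const 2^-1) (@cesaro_meanZ 2^-1 _ _ (cesaro_mean_cosM ne)).
by rewrite mulr0 addr0.
Qed.

(** Parseval: in the expanded square the cross terms average to 0. Since [cos (t * x)] depends only
    on [cos x], it is the cosines that have to be distinct. *)
Lemma cesaro_mean_trig_sum_sqr (I : finType) (theta c : I -> R) :
  injective (cos \o theta) ->
  cesaro_mean (fun t => (\sum_i c i * cos (t%:R * theta i)) ^+ 2)
    (\sum_i (if cos (theta i) ^+ 2 == 1 then 1 else 2^-1) * c i ^+ 2).
Proof.
move=> inj.
apply: (@cesaro_mean_ext (fun t => \sum_i \sum_j
    (c i * c j) * (cos (t%:R * theta i) * cos (t%:R * theta j)))).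
  move=> t; rewrite expr2 mulr_suml; apply: eq_bigr => i _; rewrite mulr_sumr.
  by apply: eq_bigr => j _; rewrite mulrACA.
apply: cesaro_mean_sum => i.
have -> : (if cos (theta i) ^+ 2 == 1 then 1 else 2^-1) * c i ^+ 2 =
   \sum_j (c i * c j) * (if j == i then if cos (theta i) ^+ 2 == 1 then 1 else 2^-1 else 0).
  rewrite (bigD1 i) //= eqxx big1 ?addr0 => [|j /negPf ->]; last by rewrite mulr0.
  by rewrite -expr2 mulrC.
apply: cesaro_mean_sum => j; apply: cesaro_meanZ; case: eqP => [->|/eqP ji].
  exact: cesaro_mean_cos_sqr.
by apply: cesaro_mean_cosM; apply: contra ji => /eqP /inj ->.
Qed.

End CesaroMeans.

(** * Cauchy-Schwarz and its equality case *)

Section Spread.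
Variables (R : realFieldType) (I : finType) (P : pred I).

(* The defect in Cauchy-Schwarz. For empty [P] it is 0, because 0^-1 = 0, in
   accordance with the pseudo-inverse of [Delta] at a vertex without unmarked
   neighbors. *)
Definition spread (h : I -> R) : R :=
  \sum_(i | P i) h i ^+ 2 - #|P|%:R^-1 * (\sum_(i | P i) h i) ^+ 2.

Lemma spreadE (h : I -> R) :
  spread h = \sum_(i | P i) (h i - #|P|%:R^-1 * \sum_(j | P j) h j) ^+ 2.
Proof.
rewrite /spread; set s := \sum_(j | P j) h j; set d := #|P|%:R^-1.
under [RHS]eq_bigr do rewrite sqrrB.
rewrite big_split /= big_split /= sumrN sumr_const -/d.
rewrite sumrMnl -mulr_suml -/s -[in X in _ = _ + X]mulr_natl exprMn.
have [P0|P0] := eqVneq #|P| 0%N; first by rewrite /d P0 invr0; ring.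
by rewrite /d; field; rewrite pnatr_eq0.
Qed.

Lemma spread_ge0 (h : I -> R) : 0 <= spread h.
Proof. by rewrite spreadE sumr_ge0 // => i _; rewrite sqr_ge0. Qed.

Lemma spread_eq0P (h : I -> R) :
  spread h = 0 <-> (forall i j, P i -> P j -> h i = h j).
Proof.
split=> [/eqP|hh].
  rewrite spreadE psumr_eq0 => [/allP s0 i j Pi Pj|i _]; last exact: sqr_ge0.
  have mean l : P l -> h l = #|P|%:R^-1 * \sum_(j | P j) h j.
    move=> Pl; have := s0 l (mem_index_enum _).
    by rewrite Pl sqrf_eq0 subr_eq0 => /eqP.
  by rewrite (mean i) // (mean j).
rewrite spreadE big1 // => i Pi.
have P0 : #|P|%:R != 0 :> R by rewrite pnatr_eq0 -lt0n; apply/card_gt0P; exists i.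
rewrite (eq_bigr (fun=> h i)) => [|j Pj]; last exact: hh.
by rewrite sumr_const -[h i *+ _]mulr_natl mulKf // subrr expr0n.
Qed.

End Spread.

(** * From the walk on arcs to a wave equation on vertices *)

Section WalkDynamics.
Variables (R : realType) (V : finType) (e : rel V) (k : nat) (S : {set V}).

Lemma sum_arcs_from (phi : V * V -> R) x :
  \sum_(a in arcs e) (x == a.1)%:R * phi a = \sum_(y | e x y) phi (x, y).
Proof.
rewrite [RHS](_ : _ = \sum_(z | z == x) \sum_(y | e z y) phi (z, y)); last first.
  by rewrite big_pred1_eq.
rewrite pair_big_dep (eq_bigr (fun a => if a.1 == x then phi a else 0)).
  rewrite -big_mkcondr; apply: eq_big => [[y z]|[y z]] //=.
  by rewrite inE andbC.
by move=> a _; rewrite eq_sym; case: eqP; rewrite (mul1r, mul0r).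
Qed.

Hypothesis e_sym : symmetric e.

Lemma arc_reversal_col (phi : V * V -> R) (a : 'I_#|arcs e|) :
  (arc_reversal R e *m \col_b phi (enum_val b)) a 0
  = phi ((enum_val a).2, (enum_val a).1).
Proof.
rewrite mxE; set p := (_, _).
under eq_bigr do rewrite !mxE -/p.
rewrite -(big_enum_val (fun b => (b == p)%:R * phi b)) (bigD1 p) /=.
  rewrite eqxx mul1r big1 ?addr0 // => b /andP[_ /negPf ->]; exact: mul0r.
by rewrite inE /= e_sym; have := enum_valP a; rewrite inE.
Qed.

Lemma diffusion_col (phi : V * V -> R) :
  (tail_incidence R e)^T *m oracle R S *m tail_incidence R e
    *m \col_b phi (enum_val b)
  = \col_a (((enum_val a).1 \notin S)%:R *
      \sum_(y | e (enum_val a).1 y) phi ((enum_val a).1, y)).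
Proof.
rewrite -!mulmxA; pose psi x := \sum_(y | e x y) phi (x, y).
have -> : tail_incidence R e *m \col_b phi (enum_val b)
        = \col_i psi (enum_val i).
  apply/colP => i; rewrite mxE [RHS]mxE /psi -sum_arcs_from [RHS]big_enum_val.
  by apply: eq_bigr => b _; rewrite !mxE.
have sumT (F : V -> R) : \sum_(i < #|[set: V]|) F (enum_val i) = \sum_x F x.
  by rewrite -(big_enum_val F); apply: eq_bigl => x; rewrite inE.
have -> (F : V -> R) : oracle R S *m (\col_i F (enum_val i))
        = \col_i ((enum_val i \notin S)%:R * F (enum_val i)).
  apply/colP => i; rewrite !mxE; under eq_bigr do rewrite !mxE.
  rewrite (sumT (fun y => ((enum_val i == y) && (enum_val i \notin S))%:R * F y)).
  rewrite (bigD1 (enum_val i)) //= eqxx big1 ?addr0 // => y.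
  by rewrite eq_sym => /negPf ->; rewrite mul0r.
apply/colP => a; rewrite !mxE; under eq_bigr do rewrite !mxE.
rewrite (sumT (fun x => (x == (enum_val a).1)%:R *
   ((x \notin S)%:R * psi x))).
rewrite (bigD1 (enum_val a).1) //= eqxx mul1r big1 ?addr0 // => x /negPf ->.
by rewrite mul0r.
Qed.

Lemma transition_col (phi : V * V -> R) (a : 'I_#|arcs e|) :
  let u := (enum_val a).1 in let w := (enum_val a).2 in
  (transition R e k S *m \col_b phi (enum_val b)) a 0
  = 2 / k%:R * ((w \notin S)%:R * \sum_(y | e w y) phi (w, y)) - phi (w, u).
Proof.
move=> u w; rewrite -mulmxA mulmxBl -scalemxAl diffusion_col mul1mx.
rewrite -(arc_reversal_col (fun b => 2 / k%:R *
  ((b.1 \notin S)%:R * \sum_(y | e b.1 y) phi (b.1, y)) - phi b)).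
by congr ((_ *m _) _ _); apply/colP => b; rewrite !mxE.
Qed.

Lemma vertex_stateE v (a : 'I_#|arcs e|) :
  vertex_state R e k v a 0 = (Num.sqrt k%:R)^-1 * ((enum_val a).1 == v)%:R.
Proof.
rewrite !mxE; congr (_ * _); under eq_bigr do rewrite !mxE.
rewrite -(big_enum_val (fun x => (x == (enum_val a).1)%:R * (x == v)%:R)) /=.
rewrite (bigD1 (enum_val a).1) ?inE //= eqxx mul1r big1 ?addr0 // => x.
by case/andP => _ /negPf ->; rewrite mul0r.
Qed.

(* The walk started at a vertex state is driven by a discrete wave equation for
   a function on the vertices; [f t] stands for the wave at time [t - 1]. *)
Lemma wave_amplitude (f : nat -> V -> R) v :
  regular_graph e k ->
  (forall u w, f 1%N w - f 0%N u = (u == v)%:R) ->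
  (forall t w, w \in S -> f t.+2 w = f t w) ->
  (forall t w, w \notin S ->
     f t.+2 w + f t w = 2 / k%:R * \sum_(y | e w y) f t.+1 y) ->
  forall t (a : 'I_#|arcs e|),
  (transition R e k S ^+ t *m vertex_state R e k v) a 0
  = (Num.sqrt k%:R)^-1 * (f t.+1 (enum_val a).2 - f t (enum_val a).1).
Proof.
move=> reg f0 fS fnS t; elim: t => [|t IH] a.
  by rewrite expr0 mul1mx vertex_stateE f0.
rewrite exprS -mulmxE -mulmxA.
pose phi (b : V * V) := (Num.sqrt k%:R)^-1 * (f t.+1 b.2 - f t b.1).
have -> : transition R e k S ^+ t *m vertex_state R e k v = \col_b phi (enum_val b).
  by apply/colP => b; rewrite IH mxE.
rewrite transition_col /phi /=; set u := _.1; set w := _.2.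
have [wS|wS] := boolP (w \in S); first by rewrite /= mul0r mulr0 fS //; ring.
have k0 : k%:R != 0 :> R.
  rewrite pnatr_eq0 -(reg w) -lt0n; apply/card_gt0P; exists u.
  by rewrite inE e_sym; have := enum_valP a; rewrite inE.
rewrite /= mul1r -mulr_sumr sumrB sumr_const.
have -> : #|[pred y | e w y]| = k by exact: reg.
(* The [k] arcs leaving [w] contribute [- 2 * f t w] and the reversed arc [+ f t w], which together
   give the [- f t w] of the recurrence. *)
have -> : f t.+2 w = 2 / k%:R * \sum_(y | e w y) f t.+1 y - f t w.
  by rewrite -fnS // addrK.
rewrite -[f t w *+ k]mulr_natl; set c := (Num.sqrt _)^-1.
by field.
Qed.

End WalkDynamics.

Lemma avg_mixing_cesaro (R : realType) (V : finType) (e : rel V) k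
    (S : {set V}) (u v : V) (l : R) :
  cesaro_mean (fun t => mixing R e k S t u v) l -> avg_mixing R e k S u v = l.
Proof. exact: cvg_lim. Qed.

(** * The explicit wave and the average mixing of marked vertices *)

Section AverageMixing.
Variables (R : realType) (V : finType) (e : rel V) (k m : nat) (S : {set V}).
Variables (lambda : 'I_m -> R) (eta : 'I_m -> V -> R) (u v : V).
Hypothesis e_sym : symmetric e.
Hypothesis ereg : regular_graph e k.
Hypothesis k_gt0 : (0 < k)%N.
Hypotheses (lambda_inj : injective lambda)
  (lambda_lt : forall r, `|lambda r| < k%:R).
Hypotheses (uS : u \in S) (vS : v \in S).
(* [eta r] is the image under the r-th eigenprojection of the column [v] of
   the adjacency matrix, extended by zero to [S]. *)
Hypothesis eta0 : forall r x, x \in S -> eta r x = 0.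
Hypothesis eta_eigen : forall r x, x \notin S ->
  \sum_(y | e x y) eta r y = lambda r * eta r x.
Hypothesis eta_sum : forall x, x \notin S -> \sum_r eta r x = (e x v)%:R.

Let theta r := acos (lambda r / k%:R).
Let gamma r x := k%:R / (k%:R ^+ 2 - lambda r ^+ 2) * eta r x.

Let k_neq0 : k%:R != 0 :> R. Proof. by rewrite pnatr_eq0 -lt0n. Qed.

Let lambda_bounds r : -k%:R < lambda r < k%:R.
Proof. by rewrite -ltr_norml. Qed.

Let ratio_lt1 r : -1 < lambda r / k%:R < 1.
Proof.
by rewrite ltr_pdivlMr ?ltr_pdivrMr ?ltr0n // mulN1r mul1r.
Qed.

Let subk_neq0 r : k%:R - lambda r != 0.
Proof. by have := lambda_bounds r; lra. Qed.

Let addk_neq0 r : k%:R + lambda r != 0.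
Proof. by have := lambda_bounds r; lra. Qed.

Let sqrk_neq0 r : k%:R ^+ 2 - lambda r ^+ 2 != 0.
Proof. by rewrite subr_sqr mulf_neq0. Qed.

Let cos_theta r : cos (theta r) = lambda r / k%:R.
Proof. by apply: acosK; have := ratio_lt1 r; rewrite in_itv /=; lra. Qed.

(** On [S] only the last term survives: it is a source at [v] with frequencies 0 and pi. Off [S],
    the terms in 1 and [(-1) ^+ n] are the response to this source and the cosine is a free
    solution; the factor in [gamma] makes them cancel at [n = 0] and [n = 1]. *)
Definition wave (n : nat) (w : V) : R :=
  \sum_r gamma r w * (cos (n%:R * theta r - theta r)
     - (1 + lambda r / k%:R) / 2 + (-1) ^+ n * (1 - lambda r / k%:R) / 2)
  - (w == v)%:R * (1 + (-1) ^+ n) / 2.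

Lemma wave_init x w : wave 1 w - wave 0 x = (x == v)%:R.
Proof.
rewrite /wave big1 => [|r _]; first last.
  by rewrite mul1r subrr cos0; field.
rewrite big1 => [|r _]; last by rewrite mul0r sub0r cosN cos_theta; field.
by field.
Qed.

Lemma wave_marked n w : w \in S -> wave n.+2 w = wave n w.
Proof.
move=> wS; rewrite /wave !exprS mulrA mulrNN !mul1r; congr (_ - _).
by apply: eq_bigr => r _; rewrite /gamma eta0 // mulr0 !mul0r.
Qed.

Lemma wave_unmarked n w : w \notin S ->
  wave n.+2 w + wave n w = 2 / k%:R * \sum_(y | e w y) wave n.+1 y.
Proof.
move=> wS; have wv : w == v = false by apply: contraNF wS => /eqP ->.
rewrite /wave wv !mul0r !subr0 -big_split sumrB /= exchange_big /=.
(* The source reaches [w] through the edge to [v], if any. Expanding that adjacency entry by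
   [eta_sum] leaves one identity for each [r]. *)
have -> : \sum_(y | e w y) (y == v)%:R * (1 + (-1) ^+ n.+1) / 2
        = \sum_r eta r w * (1 - (-1) ^+ n) / 2 :> R.
  rewrite -!mulr_suml eta_sum // exprS mulN1r; congr (_ * _ / _).
  have [ev|ev] := boolP (e w v).
    by rewrite (bigD1 v) //= eqxx big1 ?addr0 // => y /andP[_ /negPf ->].
  by rewrite big1 // => y ey; case: eqP => // yv; rewrite -yv ey in ev.
rewrite -sumrB mulr_sumr; apply: eq_bigr => r _.
rewrite -mulr_suml -mulr_sumr eta_eigen // /gamma !exprS.
rewrite -!(natr1 _ : _%:R + 1 = _.+1%:R).
have -> : (n%:R + 1 + 1) * theta r - theta r = n%:R * theta r + theta r by ring.
have -> : (n%:R + 1) * theta r - theta r = n%:R * theta r by ring.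
rewrite !cosD cosN sinN cos_theta; field.
by rewrite k_neq0 sqrk_neq0.
Qed.

Definition frequency (j : bool + 'I_m) : R :=
  match j with inl b => b%:R * pi | inr r => theta r end.

Definition wave_coef (w : V) (j : bool + 'I_m) : R :=
  match j with
  | inl false =>
      ((u == v)%:R - (w == v)%:R - \sum_r eta r w / (k%:R - lambda r)) / 2
  | inl true =>
      ((u == v)%:R + (w == v)%:R - \sum_r eta r w / (k%:R + lambda r)) / 2
  | inr r => gamma r w
  end.

Lemma cos_frequency j : cos (frequency j) =
  match j with inl b => (-1) ^+ b | inr r => lambda r / k%:R end.
Proof.
case: j => [[]|r] /=; last exact: cos_theta.
  by rewrite mul1r cospi.
by rewrite mul0r cos0.
Qed.

(** The strict bound [|lambda r| < k] keeps the ratios [lambda r / k] apart from 1 and -1. *)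
Lemma cos_frequency_inj : injective (cos \o frequency).
Proof.
move=> i j /=; rewrite !cos_frequency.
have ne b r : (-1) ^+ nat_of_bool b = lambda r / k%:R -> False.
  by have := ratio_lt1 r; case: b; rewrite ?expr0 ?expr1; lra.
case: i j => [b|r] [b'|s].
- by case: b; case: b' => //; rewrite expr0 expr1 => ?; exfalso; lra.
- by move/ne => [].
- by move/esym/ne => [].
- by move/(mulIf _)=> /(_ (invr_neq0 k_neq0)) /lambda_inj ->.
Qed.

Lemma cos_natpi (t : nat) : cos (t%:R * pi) = (-1) ^+ t :> R.
Proof.
elim: t => [|t IH]; first by rewrite mul0r cos0.
by rewrite -(natr1 t) mulrDl mul1r cosDpi IH exprS mulN1r.
Qed.

Lemma wave_frequencies t w :
  wave t.+1 w - wave t u = \sum_j wave_coef w j * cos (t%:R * frequency j).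
Proof.
rewrite big_sumType big_bool /= mul1r mul0r mulr0 cos0 cos_natpi.
(* As [u] is marked, [wave t u] reduces to its source term. *)
rewrite /wave [X in _ - (X - _)]big1 => [|r _]; last first.
  by rewrite /gamma eta0 // mulr0 mul0r.
(* Partial fractions: [gamma r w * (1 + lambda r / k)] is [eta r w / (k - lambda r)], and likewise
   with both signs exchanged. *)
have -> : \sum_r gamma r w * (cos (t.+1%:R * theta r - theta r)
      - (1 + lambda r / k%:R) / 2 + (-1) ^+ t.+1 * (1 - lambda r / k%:R) / 2)
    = \sum_r gamma r w * cos (t%:R * theta r)
      - (\sum_r eta r w / (k%:R - lambda r)) / 2
      - (-1) ^+ t * ((\sum_r eta r w / (k%:R + lambda r)) / 2).
  rewrite !mulr_suml mulr_sumr -!sumrB; apply: eq_bigr => r _.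
  rewrite -(natr1 t) mulrDl mul1r addrK /gamma (exprS _ t); field.
  by rewrite k_neq0 sqrk_neq0 subk_neq0 addk_neq0.
by rewrite (exprS _ t); field.
Qed.

Lemma mixing_wave t : mixing R e k S t u v = k%:R^-1 *
  \sum_(w | e u w) (\sum_j wave_coef w j * cos (t%:R * frequency j)) ^+ 2.
Proof.
rewrite /mixing mulr_sumr -(sum_arcs_from e (fun a => k%:R^-1 *
  (\sum_j wave_coef a.2 j * cos (t%:R * frequency j)) ^+ 2)) [RHS]big_enum_val.
rewrite [LHS]big_mkcond; apply: eq_bigr => a _; rewrite eq_sym.
case: eqP => [ua|_]; last by rewrite mul0r.
rewrite (wave_amplitude e_sym ereg wave_init wave_marked wave_unmarked) -ua.
by rewrite real_normK ?num_real // wave_frequencies exprMn exprVn sqr_sqrtr ?ler0n ?mul1r.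
Qed.

Lemma avg_mixing_wave : avg_mixing R e k S u v = k%:R^-1 *
  \sum_(w | e u w) (\sum_r gamma r w ^+ 2 / 2
    + wave_coef w (inl false) ^+ 2 + wave_coef w (inl true) ^+ 2).
Proof.
apply: avg_mixing_cesaro.
apply: (cesaro_mean_ext (fun t => esym (mixing_wave t))).
apply: cesaro_meanZ; apply: cesaro_mean_sum => w.
have := @cesaro_mean_trig_sum_sqr _ _ _ (wave_coef w) cos_frequency_inj.
rewrite big_sumType big_bool !cos_frequency expr1 expr0 sqrrN expr1n eqxx !mul1r.
rewrite addrC addrA (addrAC _ _ (_ ^+ 2)).
congr (cesaro_mean _ (_ + _ + _)); apply: eq_bigr => r _.
rewrite cos_frequency mulrC; case: eqP => // /eqP.
by rewrite sqrf_eq1; have := ratio_lt1 r => ? /orP[] /eqP; lra.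
Qed.

Lemma avg_mixing_eta : avg_mixing R e k S u v =
  (2 * k%:R)^-1 * ((nb_in e S u)%:R * (u == v)%:R + (e u v)%:R)
  + \sum_(w in ~: S | e u w)
      (\sum_r k%:R / (2 * (k%:R ^+ 2 - lambda r ^+ 2) ^+ 2) * eta r w ^+ 2
       + (4 * k%:R)^-1 * ((u == v)%:R - \sum_r eta r w / (k%:R - lambda r)) ^+ 2
       + (4 * k%:R)^-1 * ((u == v)%:R - \sum_r eta r w / (k%:R + lambda r)) ^+ 2).
Proof.
rewrite avg_mixing_wave (bigID (mem S)) /= mulrDr; congr (_ + _).
  (* For marked [w] only the indicators a, b of [u = v] and [w = v] remain, and [((a - b)/2)^2 + ((a
     + b)/2)^2 = (a + b)/2] because they are idempotent. *)
  transitivity (k%:R^-1 * \sum_(w | e u w && (w \in S))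
      (2^-1 * ((u == v)%:R + (w == v)%:R)) : R).
    congr (_ * _); apply: eq_bigr => w /andP[_ wS].
    have eta_c (c : 'I_m -> R) : \sum_r eta r w / c r = 0.
      by rewrite big1 // => r _; rewrite eta0 // mul0r.
    rewrite !eta_c big1 => [|r _]; last by rewrite /gamma eta0 // mulr0 expr0n mul0r.
    by case: eqP; case: eqP => _ _ /=; field.
  rewrite -mulr_sumr big_split /= sumr_const.
  have -> : #|[pred w | e u w && (w \in S)]| = nb_in e S u.
    by apply: eq_card => w; rewrite !inE andbC.
  have -> : \sum_(w | e u w && (w \in S)) (w == v)%:R = (e u v)%:R :> R.
    have [ev|ev] := boolP (e u v).
      by rewrite (bigD1 v) ?ev //= eqxx big1 ?addr0 // => y /andP[_ /negPf ->].
    by rewrite big1 // => y /andP[ey _]; case: eqP => // yv; rewrite -yv ey in ev.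
  by rewrite -mulr_natl; field.
rewrite mulr_sumr; apply: eq_big => [w|w /andP[_ wS]]; first by rewrite inE andbC.
have -> : w == v = false by apply: contraNF wS => /eqP ->.
rewrite /= subr0 addr0 !mulrDr mulr_sumr; congr (_ + _ + _); try by field.
by apply: eq_bigr => r _; rewrite /gamma; field; rewrite k_neq0 sqrk_neq0.
Qed.

End AverageMixing.

(** * Eigenvalues of the graph outside S *)

Section DirichletEigenvalues.
Variables (R : realFieldType) (V : finType) (e : rel V) (k : nat) (S : {set V}).

(* Maximum principle: were |lambda| >= k, the set where |phi| is maximal would
   be closed under adjacency, hence would meet S. *)
Lemma dirichlet_eigenvalue_lt (lambda : R) (phi : V -> R) x0 :
  regular_graph e k -> connected_graph e -> S != finset.set0 ->
  (forall x, x \in S -> phi x = 0) ->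
  (forall x, x \notin S -> \sum_(y | e x y) phi y = lambda * phi x) ->
  phi x0 != 0 -> `|lambda| < k%:R.
Proof.
move=> reg con /set0Pn[s sS] phiS phi_eig nz.
rewrite ltNge; apply/negP => le_k.
pose x1 := [arg max_(x > x0) `|phi x|]%O.
have maxP y : `|phi y| <= `|phi x1|.
  by rewrite /x1; case: Order.TotalTheory.arg_maxP => // x _; apply.
have max0 : 0 < `|phi x1| by apply: lt_le_trans (maxP x0); rewrite normr_gt0.
have step x y : `|phi x| = `|phi x1| -> e x y -> `|phi y| = `|phi x1|.
  move=> xmax exy; have xS : x \notin S.
    by apply: contraTN max0 => xS; rewrite -xmax phiS // normr0 ltxx.
  (* At a maximum, [k * |phi x| <= |lambda * phi x|], which is at most the sum of [|phi z|] over the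
     neighbors. The summands here are nonnegative, so each vanishes. *)
  have sum_le0 : \sum_(z | e x z) (`|phi x1| - `|phi z|) <= 0.
    rewrite sumrB sumr_const (_ : #|_| = k); last exact: reg.
    rewrite subr_le0 -[_ *+ k]mulr_natl.
    apply: le_trans (ler_norm_sum _ _ _).
    by rewrite phi_eig // normrM xmax ler_wpM2r.
  have ge0 z : e x z -> 0 <= `|phi x1| - `|phi z| by rewrite subr_ge0.
  have /eqP : \sum_(z | e x z) (`|phi x1| - `|phi z|) = 0.
    by apply: le_anti; rewrite sum_le0 sumr_ge0.
  rewrite psumr_eq0 // => /allP /(_ y (mem_index_enum _)).
  by rewrite exy subr_eq0 => /eqP.
have /connectP[p] := con x1 s.
have : `|phi x1| = `|phi x1| by [].
elim: p {-2}x1 => [|y p IH] x /= xmax.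
  by move=> _ xs; move: max0; rewrite -xmax -xs phiS // normr0 ltxx.
by case/andP => exy; apply: IH; exact: step exy.
Qed.

End DirichletEigenvalues.

(** * The pseudo-inverse of a diagonal matrix *)

Section PseudoInverse.
Variable R : realType.

(** [A *m B] and [A *m C] are orthogonal projections with the same range, [B *m A] and [C *m A] with
    the same kernel; hence [B = B A B = C A C = C]. *)
Lemma pseudo_inverse_unique (m n : nat) (A : 'M[R]_(m, n)) (B C : 'M[R]_(n, m)) :
  is_pseudo_inverse A B -> is_pseudo_inverse A C -> B = C.
Proof.
move=> [b1 b2 b3 b4] [c1 c2 c3 c4].
have AB : A *m B = A *m C.
  have h : (A *m C) *m (A *m B) = A *m B by rewrite mulmxA c1.
  by rewrite -b3 -h trmx_mul b3 c3 mulmxA b1.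
have BA : B *m A = C *m A.
  have h : (B *m A) *m (C *m A) = B *m A by rewrite -mulmxA (mulmxA A) c1.
  by rewrite -b4 -h trmx_mul b4 c4 -mulmxA (mulmxA A) b1.
by rewrite -b2 -mulmxA AB mulmxA BA c2.
Qed.

Lemma pseudo_inverse_diag (n : nat) (d : 'rV[R]_n) :
  pseudo_inverse (diag_mx d) = diag_mx (map_mx GRing.inv d).
Proof.
apply: xget_unique => [|B hB]; last apply: pseudo_inverse_unique hB _;
  (split; rewrite ?mulmx_diag ?tr_diag_mx //; congr diag_mx; apply/rowP => j;
   rewrite !mxE; have [->|nz] := eqVneq (d 0 j) 0; rewrite ?invr0 ?mulr0 //;
   by field).
Qed.

End PseudoInverse.

(** Vandermonde: the hypothesis extends linearly to all polynomials in [lambda], and the one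
    vanishing at every node except [lambda r] isolates [d r]. *)
Lemma power_sums_eq0 (R : fieldType) (m : nat) (lambda d : 'I_m -> R) :
  injective lambda -> (forall n, \sum_r lambda r ^+ n * d r = 0) ->
  forall r, d r = 0.
Proof.
move=> inj h r.
pose p := \prod_(s | s != r) ('X - (lambda s)%:P).
have hp (q : {poly R}) : \sum_s q.[lambda s] * d s = 0.
  under eq_bigr do rewrite horner_coef mulr_suml.
  rewrite exchange_big big1 //= => i _.
  by under eq_bigr do rewrite -mulrA; rewrite -mulr_sumr h mulr0.
have := hp p; rewrite (bigD1 r) //= big1 => [|s sr].
  rewrite addr0 => /eqP; rewrite mulf_eq0 => /orP[|/eqP //].
  rewrite horner_prod prodf_seq_eq0 => /hasP[s _ /andP[sr]].
  by rewrite hornerXsubC subr_eq0 => /eqP /inj rs; rewrite rs eqxx in sr.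
by rewrite horner_prod (bigD1 s) //= hornerXsubC subrr !mul0r.
Qed.

(** * Recursive count of the walks outside S *)

Section Walks.
Variables (R : realType) (V : finType) (e : rel V) (S : {set V}).

Lemma nb_walks_out0 u b : u \notin S -> nb_walks_out e S 0 u b = e b u.
Proof.
move=> uS; rewrite /nb_walks_out; case eub : (e b u); last first.
  by apply: eq_card0 => p; rewrite [p]tuple0 !inE /= eub andbF.
rewrite (eq_card (_ : _ =i predT)) ?card_tuple // => p.
by rewrite [p]tuple0 !inE /= uS.
Qed.

Lemma nb_walks_outS n u b : u \notin S ->
  nb_walks_out e S n.+1 u b = (\sum_(x in ~: S | e u x) nb_walks_out e S n x b)%N.
Proof.
move=> uS; rewrite /nb_walks_out -sum1_card.
under [RHS]eq_bigr do rewrite -sum1_card.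
rewrite pair_big_dep (reindex (fun q : V * n.-tuple V => [tuple of q.1 :: q.2])) /=.
  apply: eq_bigl => -[x p]; rewrite !inE /=.
  have -> : edges_in e (~: S) u x = (x \notin S) && e u x.
    by rewrite /edges_in /= !inE uS andbC.
  by rewrite -!andbA.
exists (fun p => (thead p, [tuple of behead p])) => [[x p] _|p _] /=.
  by congr pair; apply: val_inj.
by rewrite [RHS]tuple_eta.
Qed.

End Walks.

(** * Functional calculus of a spectral decomposition *)

Section SpectralDecomposition.
Variables (R : realType) (n m : nat) (A : 'M[R]_n).
Variables (lambda : 'I_m -> R) (G : 'I_m -> 'M[R]_n).
Hypothesis AG : spectral_decomposition A lambda G.

Lemma spectral_mull (c : 'I_m -> R) r :
  (\sum_s c s *: G s) *m G r = c r *: G r.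
Proof.
case: AG => _ idem ortho _ _; rewrite mulmx_suml (bigD1 r) //= big1 => [|s sr].
  by rewrite addr0 -scalemxAl; case: (idem r) => _ _ ->.
by rewrite -scalemxAl ortho // scaler0.
Qed.

Lemma spectral_eigen r : A *m G r = lambda r *: G r.
Proof. by case: (AG) => _ _ _ _ ->; exact: spectral_mull. Qed.

Lemma spectral_inv (c : 'I_m -> R) : (forall r, c r != 0) ->
  invmx (\sum_r c r *: G r) = \sum_r (c r)^-1 *: G r.
Proof.
move=> c0; have eq1 : (\sum_r c r *: G r) *m (\sum_r (c r)^-1 *: G r) = 1%:M.
  case: (AG) => _ _ _ <- _; rewrite mulmx_sumr; apply: eq_bigr => r _.
  by rewrite -scalemxAr spectral_mull scalerA mulVf // scale1r.
have [uc _] := mulmx1_unit eq1.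
by rewrite -[RHS](mulKmx uc) eq1 mulmx1.
Qed.

End SpectralDecomposition.

(** * Adjacency blocks and eigenparts *)

Section Blocks.
Variables (R : realType) (V : finType) (e : rel V) (k m : nat) (S : {set V}).
Implicit Types (g : 'cV[R]_#|~: S|).

(** Written as a sum with at most one term, so that a marked [x], which has no index, gets the value
    0. *)
Definition extend0 g (x : V) : R := \sum_(i | enum_val i == x) g i 0.

Lemma extend0_val g i : extend0 g (enum_val i) = g i 0.
Proof.
rewrite /extend0 (big_pred1 i) // => j; apply/eqP/eqP => [|->] //.
exact: enum_val_inj.
Qed.

Lemma extend0_marked g x : x \in S -> extend0 g x = 0.
Proof.
move=> xS; rewrite /extend0 big1 // => i /eqP ix.
by have := enum_valP i; rewrite ix inE xS.
Qed.

Lemma sum_unmarked (Q : pred V) (F : V -> R) :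
  \sum_(w in ~: S | Q w) F w
  = \sum_(i < #|~: S|) (Q (enum_val i))%:R * F (enum_val i).
Proof.
rewrite -(big_enum_val (fun w => (Q w)%:R * F w)) big_mkcondr.
by apply: eq_bigr => w _; case: (Q w); rewrite (mul1r, mul0r).
Qed.

Lemma sum_extend0 x g : \sum_(y | e x y) extend0 g y
  = \sum_(i < #|~: S|) adj R e x (enum_val i) * g i 0.
Proof.
rewrite (bigID (mem S)) /= big1 ?add0r => [|y /andP[_ /extend0_marked ->] //].
transitivity (\sum_(y in ~: S | e x y) extend0 g y).
  by apply: eq_bigl => y; rewrite inE andbC.
by rewrite sum_unmarked; apply: eq_bigr => i _; rewrite extend0_val.
Qed.

Lemma extend0_eigen (a : R) g : mxof (adj R e) (~: S) (~: S) *m g = a *: g ->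
  forall x, x \notin S -> \sum_(y | e x y) extend0 g y = a * extend0 g x.
Proof.
move=> Ag x xS; have xS' : x \in ~: S by rewrite inE.
rewrite sum_extend0 -(enum_rankK_in xS' xS') extend0_val.
have := congr1 (fun h : 'cV_ _ => h (enum_rank_in xS' x) 0) Ag.
by rewrite /= !mxE => <-; apply: eq_bigr => i _; rewrite !mxE.
Qed.

(** For marked [v] the column is $H^Te_v$, and [eigenpart (G r) v] serves as [eta r]. *)
Definition eigenpart (G : 'M[R]_#|~: S|) (v : V) : V -> R :=
  extend0 (G *m \col_i adj R e (enum_val i) v).

Lemma block_form (G : 'M[R]_#|~: S|) (i j : 'I_#|S|) :
  symmetric e ->
  (mxof (adj R e) S (~: S) *m G *m (mxof (adj R e) S (~: S))^T) i j
  = \sum_(w in ~: S | e (enum_val i) w) eigenpart G (enum_val j) w.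
Proof.
move=> e_sym; rewrite sum_unmarked -mulmxA mxE; apply: eq_bigr => l _.
rewrite /eigenpart extend0_val mxE; congr (_ * _); rewrite !mxE.
by apply: eq_bigr => l' _; rewrite !mxE /adj e_sym.
Qed.

Section Eigenparts.
Variables (lambda : 'I_m -> R) (G : 'I_m -> 'M[R]_#|~: S|).
Hypothesis AG :
  spectral_decomposition (mxof (adj R e) (~: S) (~: S)) lambda G.

Lemma eigenpart_eigen v r x : x \notin S ->
  \sum_(y | e x y) eigenpart (G r) v y = lambda r * eigenpart (G r) v x.
Proof.
by apply: extend0_eigen; rewrite mulmxA (spectral_eigen AG) scalemxAl.
Qed.

Lemma eigenpart_sum v x : x \notin S ->
  \sum_r eigenpart (G r) v x = (e x v)%:R.
Proof.
move=> xS; have xS' : x \in ~: S by rewrite inE.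
rewrite -(enum_rankK_in xS' xS'); set i := enum_rank_in _ _.
rewrite /eigenpart; under eq_bigr do rewrite extend0_val.
transitivity ((\sum_r G r *m \col_i adj R e (enum_val i) v) i 0).
  by rewrite summxE.
rewrite -mulmx_suml; case: AG => _ _ _ -> _.
by rewrite mul1mx mxE.
Qed.

(** A nonzero column of [G r], extended by 0 to [S], is an eigenfunction to which the maximum
    principle applies. *)
Lemma eigenvalue_lt : regular_graph e k -> connected_graph e ->
  S != finset.set0 -> forall r, `|lambda r| < k%:R.
Proof.
move=> reg con S0 r; case: (AG) => _ /(_ r)[nz _ _] _ _ _.
have [[i j] /= Gij] : exists p : 'I_#|~: S| * 'I_#|~: S|, G r p.1 p.2 != 0.
  apply/existsP; apply: contraR nz; rewrite negb_exists => /forallP G0.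
  apply/eqP/matrixP => i j; rewrite mxE; have := G0 (i, j); rewrite /=.
  by move/negPn/eqP.
apply: (@dirichlet_eigenvalue_lt _ _ e k S _ (extend0 (col j (G r))) (enum_val i)) => //.
- by move=> x; exact: extend0_marked.
- apply: extend0_eigen; have := spectral_eigen AG r => /(congr1 (col j)) Aj.
  apply/colP => l; have := congr1 (fun h : 'cV_ _ => h l 0) Aj.
  by rewrite !mxE => <-; apply: eq_bigr => l' _; rewrite !mxE.
- by rewrite extend0_val mxE.
Qed.

(** Prepending a step applies the adjacency matrix outside [S], which multiplies the r-th eigenpart
    by [lambda r]. *)
Lemma nb_walks_eigenparts n u b : symmetric e -> u \notin S ->
  (nb_walks_out e S n u b)%:R = \sum_r lambda r ^+ n * eigenpart (G r) b u :> R.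
Proof.
move=> e_sym; elim: n u => [|n IH] u uS.
  rewrite nb_walks_out0 // e_sym -eigenpart_sum //.
  by apply: eq_bigr => r _; rewrite mul1r.
rewrite nb_walks_outS // natr_sum.
rewrite (eq_bigr (fun x => \sum_r lambda r ^+ n * eigenpart (G r) b x)); last first.
  by move=> x; rewrite inE => /andP[xS _]; exact: IH.
rewrite exchange_big; apply: eq_bigr => r _ /=.
rewrite -mulr_sumr exprSr -mulrA -eigenpart_eigen //; congr (_ * _).
rewrite [RHS](bigID (mem S)) /= [X in _ = X + _]big1 ?add0r.
  by apply: eq_bigl => y; rewrite inE andbC.
by move=> y /andP[_ yS]; exact: extend0_marked.
Qed.

End Eigenparts.
End Blocks.

(** * Entries of the lower bound *)

Section BoundEntries.
Variables (R : realType) (V : finType) (e : rel V) (k m : nat) (S : {set V}).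
Variables (lambda : 'I_m -> R) (G : 'I_m -> 'M[R]_#|~: S|).
Hypothesis AG :
  spectral_decomposition (mxof (adj R e) (~: S) (~: S)) lambda G.
Hypotheses (e_sym : symmetric e) (ereg : regular_graph e k).

Lemma pseudo_inverse_Delta_mul (T : {set V}) (X : 'M[R]_#|S|) i j :
  (pseudo_inverse (Delta R e S T) *m X) i j
  = (nb_in e T (enum_val i))%:R^-1 * X i j.
Proof.
have -> : Delta R e S T = diag_mx (\row_l (nb_in e T (enum_val l))%:R).
  by apply/matrixP => a b; rewrite !mxE (inj_eq enum_val_inj).
rewrite pseudo_inverse_diag mxE (bigD1 i) //= !mxE eqxx mulr1n big1 ?addr0 // => l.
by rewrite eq_sym !mxE => /negPf ->; rewrite mul0r.
Qed.

Lemma slap_edges_in u v : u \in S -> v \in S ->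
  slap R (edges_in e S) u v = (nb_in e S u)%:R * (u == v)%:R + (e u v)%:R.
Proof.
move=> uS vS; rewrite /slap /adj /edges_in /= uS vS !andbT mulr_natr.
by congr (_%:R *+ _ + _); apply: eq_card => y; rewrite !inE /= uS andbC.
Qed.

(* Covers the Laplacian (s = -1) and the signless Laplacian (s = 1). *)
Lemma schur_compl_out_eigenparts (f : V -> V -> R) (s : R) (i j : 'I_#|S|) :
  let X' := remove_edges_in e S in
  (forall x y, f x y = (degree X' x)%:R *+ (x == y) + s * adj R X' x y) ->
  s ^+ 2 = 1 -> (forall r, k%:R + s * lambda r != 0) ->
  schur_compl_out f S i j
  = \sum_(w in ~: S | e (enum_val i) w) ((enum_val i == enum_val j)%:R
      - \sum_r eigenpart e (G r) (enum_val j) w / (k%:R + s * lambda r)).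
Proof.
move=> X' fE s1 nz.
have enumS (a : 'I_#|S|) : enum_val a \in S by exact: enum_valP.
have enumC (a : 'I_#|~: S|) : (enum_val a \in S) = false.
  by apply/negbTE; have := enum_valP a; rewrite inE.
have fSC : mxof f S (~: S) = s *: mxof (adj R e) S (~: S).
  apply/matrixP => a b; rewrite !mxE fE (_ : _ == _ = false) ?mulr0n ?add0r.
    by rewrite /adj /X' /remove_edges_in /= enumS enumC andbT.
  by apply/eqP => ab; have := enumS a; rewrite ab enumC.
have fCS : mxof f (~: S) S = s *: (mxof (adj R e) S (~: S))^T.
  apply/matrixP => a b; rewrite !mxE fE (_ : _ == _ = false) ?mulr0n ?add0r.
    by rewrite /adj /X' /remove_edges_in /= enumC andbT e_sym.
  by apply/eqP => ab; have := enumS b; rewrite -ab enumC.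
(* Unmarked vertices lose no edge in [X'], so their degree is still [k]. *)
have fCC : mxof f (~: S) (~: S) = \sum_r (k%:R + s * lambda r) *: G r.
  under eq_bigr do rewrite scalerDl -scalerA.
  rewrite big_split /= -!scaler_sumr; case: (AG) => _ _ _ -> <-.
  apply/matrixP => a b; rewrite !mxE fE -(inj_eq enum_val_inj) -mulr_natr.
  rewrite (_ : degree X' _ = k) /adj /X' /remove_edges_in /= ?enumC ?andbT ?mulr_natr //.
  rewrite -(ereg (enum_val a)); apply: eq_card => y.
  by rewrite !inE /= enumC andbT.
rewrite /schur_compl_out /schur_complement fSC fCS fCC (spectral_inv AG) //.
rewrite -!scalemxAl -scalemxAr scalerA -expr2 s1 scale1r.
rewrite mxE [X in _ + X]mxE mulmx_sumr mulmx_suml summxE mxE sumrB sumr_const.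
congr (_ - _).
  (* With the edges inside [S] removed, the [S] block is diagonal; its entry is distributed as one
     indicator per unmarked neighbor. *)
  rewrite fE /adj /X' /remove_edges_in /= !enumS andbF mulr0 addr0.
  rewrite -mulrnA mulnC mulrnA; congr (_%:R *+ _).
  apply: eq_card => y; rewrite -[RHS]/((y \in ~: S) && e (enum_val i) y).
  by rewrite !inE /= enumS andbC.
rewrite exchange_big; apply: eq_bigr => r _.
by rewrite -scalemxAr -scalemxAl mxE block_form // mulrC mulr_suml.
Qed.

End BoundEntries.

(** Without arcs every mixing sum is empty. This settles [k = 0], which the explicit wave excludes
    by dividing by [k]. *)
Lemma avg_mixing_degree0 (R : realType) (V : finType) (e : rel V)
    (S : {set V}) (u v : V) :
  regular_graph e 0 -> avg_mixing R e 0 S u v = 0.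
Proof.
move=> reg; apply: avg_mixing_cesaro.
apply: (@cesaro_mean_ext _ (fun=> 0)); last exact: cesaro_mean_const.
move=> t; rewrite /mixing big_pred0 // => a.
have := enum_valP a; rewrite inE => ea.
by have := reg (enum_val a).1; move/card0_eq/(_ (enum_val a).2); rewrite !inE ea.
Qed.

(** * The gap between the two sides and its vanishing *)

Theorem theorem6p4 (R : realType) (V : finType) (e : rel V) (k : nat)
    (S : {set V}) (m : nat) (lambda : 'I_m -> R)
    (G : 'I_m -> 'M[R]_(#|~: S|)) :
  simple_graph e -> regular_graph e k -> connected_graph e -> S != finset.set0 ->
  spectral_decomposition (mxof (adj R e) (~: S) (~: S)) lambda G ->
  let H : 'M[R]_(#|S|, #|~: S|) := mxof (adj R e) S (~: S) in
  let Dinv : 'M[R]_(#|S|) := pseudo_inverse (Delta R e S (~: S)) in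
  let X' : rel V := remove_edges_in e S in
  let LS : 'M[R]_(#|S|) := schur_compl_out (lap R X') S in
  let QS : 'M[R]_(#|S|) := schur_compl_out (slap R X') S in
  let M : 'M[R]_(#|S|) := mxof (avg_mixing R e k S) S S in
  let B : 'M[R]_(#|S|) :=
    (2 * k%:R)^-1 *: mxof (slap R (edges_in e S)) S S
    + Dinv *m (\sum_r (k%:R / (2 * (k%:R ^+ 2 - lambda r ^+ 2) ^+ 2)) *:
                 schur_prod (H *m G r *m H^T) (H *m G r *m H^T))
    + Dinv *m ((4 * k%:R)^-1 *: schur_prod LS LS
               + (4 * k%:R)^-1 *: schur_prod QS QS) in
  (forall i j, B i j <= M i j)
  /\ (M = B <-> walk_equitable_neighborhoods e S).
Proof.
move=> [e_sym _] reg con S0 AG H Dinv X' LS QS M B.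
have lt_k := eigenvalue_lt AG reg con S0.
have lambda_inj : injective lambda by case: AG.
have lt_ksub r : 0 < k%:R - lambda r by have := lt_k r; rewrite ltr_norml; lra.
have lt_kadd r : 0 < k%:R + lambda r by have := lt_k r; rewrite ltr_norml; lra.
pose eta r (j : 'I_#|S|) := eigenpart e (G r) (enum_val j).
pose N (i : 'I_#|S|) := [pred w in ~: S | e (enum_val i) w].
pose c r : R := k%:R / (2 * (k%:R ^+ 2 - lambda r ^+ 2) ^+ 2).
have c_gt0 r : 0 < c r.
  apply: divr_gt0; first exact: le_lt_trans (lt_k r).
  by rewrite mulr_gt0 // exprn_gt0 // subr_sqr mulr_gt0.
pose E (s : R) (i j : 'I_#|S|) w :=
  (enum_val i == enum_val j)%:R - \sum_r eta r j w / (k%:R + s * lambda r).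
have LS_E i j : LS i j = \sum_(w | N i w) E (-1) i j w.
  apply: (schur_compl_out_eigenparts AG e_sym reg (s := -1)).
  - by move=> x y; rewrite /lap mulN1r.
  - by rewrite sqrrN expr1n.
  - by move=> r; rewrite mulN1r gt_eqF.
have QS_E i j : QS i j = \sum_(w | N i w) E 1 i j w.
  apply: (schur_compl_out_eigenparts AG e_sym reg (s := 1)).
  - by move=> x y; rewrite /slap mul1r.
  - by rewrite expr1n.
  - by move=> r; rewrite mul1r gt_eqF.
(* The marked neighbors contribute equally to both sides. Over [N i], [M] has sums of squares where
   [B] has squares of sums divided by [#|N i|]. *)
have gap i j : M i j - B i j = \sum_r c r * spread (N i) (eta r j)
    + (4 * k%:R)^-1 * spread (N i) (E (-1) i j)
    + (4 * k%:R)^-1 * spread (N i) (E 1 i j).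
  have -> : B i j = (2 * k%:R)^-1 * ((nb_in e S (enum_val i))%:R
        * (enum_val i == enum_val j)%:R + (e (enum_val i) (enum_val j))%:R)
      + (nb_in e (~: S) (enum_val i))%:R^-1 * (\sum_r c r *
        (\sum_(w | N i w) eta r j w) ^+ 2)
      + (nb_in e (~: S) (enum_val i))%:R^-1 * ((4 * k%:R)^-1 * LS i j ^+ 2
        + (4 * k%:R)^-1 * QS i j ^+ 2).
    rewrite mxE [X in X + _]mxE !pseudo_inverse_Delta_mul summxE.
    rewrite [X in X + _ + _ = _]mxE [X in _ * X + _ + _ = _]mxE.
    rewrite slap_edges_in ?enum_valP //.
    congr (_ + _ * _ + _ * _).
      apply: eq_bigr => r _; rewrite mxE; congr (_ * _).
      by rewrite mxE block_form // expr2.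
    by rewrite !mxE !expr2.
  rewrite LS_E QS_E mxE.
  have -> : avg_mixing R e k S (enum_val i) (enum_val j) =
    (2 * k%:R)^-1 * ((nb_in e S (enum_val i))%:R
        * (enum_val i == enum_val j)%:R + (e (enum_val i) (enum_val j))%:R)
    + \sum_(w | N i w) (\sum_r c r * eta r j w ^+ 2
       + (4 * k%:R)^-1 * E (-1) i j w ^+ 2 + (4 * k%:R)^-1 * E 1 i j w ^+ 2).
    have [k0|k0] := posnP k.
      move: (reg); rewrite k0 => reg0; rewrite avg_mixing_degree0 //.
      rewrite mulr0 invr0 mul0r add0r big_pred0 // => w.
      have := reg0 (enum_val i); move/card0_eq/(_ w); rewrite !inE.
      by move=> /= ->; rewrite andbF.
    rewrite (avg_mixing_eta e_sym reg k0 lambda_inj lt_k (enum_valP i)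
      (enum_valP j) (eta := fun r => eta r j)) => [|r x|r x|x].
    - congr (_ + _); apply: eq_bigr => w _; rewrite /E.
      congr (_ + _ * (_ - _) ^+ 2 + _ * (_ - _) ^+ 2); apply: eq_bigr => r _.
        by rewrite mulN1r.
      by rewrite mul1r.
    - exact: extend0_marked.
    - exact: (eigenpart_eigen AG).
    - exact: (eigenpart_sum AG).
  rewrite /spread 2!big_split /= exchange_big /= -!mulr_sumr.
  have -> : \sum_r \sum_(w | N i w) c r * eta r j w ^+ 2
    = \sum_r c r * \sum_(w | N i w) eta r j w ^+ 2.
    by apply: eq_bigr => r _; rewrite mulr_sumr.
  under [X in _ = X + _ + _]eq_bigr do rewrite mulrBr mulrCA.
  rewrite [X in _ = X + _ + _]sumrB -[X in _ = _ - X + _ + _]mulr_sumr.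
  rewrite (_ : #|N i| = nb_in e (~: S) (enum_val i)) //.
  by ring.
have k4_ge0 : 0 <= (4 * k%:R)^-1 :> R by rewrite invr_ge0 mulr_ge0 ?ler0n.
split=> [i j|].
  rewrite -subr_ge0 gap; apply: addr_ge0; last by rewrite mulr_ge0 ?spread_ge0.
  apply: addr_ge0; last by rewrite mulr_ge0 ?spread_ge0.
  by apply: sumr_ge0 => r _; rewrite mulr_ge0 ?spread_ge0 // ltW.
(* All terms of the gap are nonnegative and each [c r] is positive, so a zero gap kills every spread
   of [eta r j]. Conversely [E s i j] is a constant minus a combination of the [eta r j], so its
   spread vanishes with theirs. *)
have MB : M = B <-> (forall i j r, spread (N i) (eta r j) = 0).
  split=> [MB i j r|sp0].
    have /eqP := gap i j; rewrite MB subrr eq_sym.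
    rewrite -addrA paddr_eq0; last first.
    - by rewrite addr_ge0 // mulr_ge0 ?spread_ge0.
    - by apply: sumr_ge0 => s _; rewrite mulr_ge0 ?spread_ge0 // ltW.
    case/andP; rewrite psumr_eq0 => [/allP /(_ r (mem_index_enum _)) /=|s _].
      by rewrite mulf_eq0 gt_eqF //= => /eqP.
    by rewrite mulr_ge0 ?spread_ge0 // ltW.
  apply/matrixP => i j; apply/eqP; rewrite -subr_eq0 gap big1 => [|r _].
    have spE s : spread (N i) (E s i j) = 0.
      apply/spread_eq0P => w w' Nw Nw'; congr (_ - _); apply: eq_bigr => r _.
      by rewrite ((spread_eq0P _ _).1 (sp0 i j r) w w').
    by rewrite !spE !mulr0 !addr0.
  by rewrite sp0 mulr0.
rewrite MB; split=> [sp0 n a b u u' aS bS uS au uS' au'|we i j r].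
  apply/eqP; rewrite -(eqr_nat R) !(nb_walks_eigenparts AG) // -?finset.in_setC //.
  apply/eqP; apply: eq_bigr => r _; congr (_ * _).
  have := sp0 (enum_rank_in aS a) (enum_rank_in bS b) r.
  move/spread_eq0P => /(_ u u'); rewrite /eta /N /= !enum_rankK_in //.
  by rewrite uS uS' au au'; apply.
apply/spread_eq0P => w w' /andP[wS iw] /andP[wS' iw'].
apply/eqP; rewrite -subr_eq0; apply/eqP.
(* The n-th power sum is the difference of the numbers of walks of length [n] from [w] and from
   [w'], which is 0 by equitability. *)
apply: (@power_sums_eq0 _ _ lambda (fun r => eta r j w - eta r j w')) => // n.
under eq_bigr do rewrite mulrBr.
rewrite sumrB -!(nb_walks_eigenparts AG) // -?finset.in_setC //.
by rewrite (we n _ _ w w' (enum_valP i) (enum_valP j)) ?subrr.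
Qed.
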